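(* Let $h:\mathbb{R}^n\to\mathbb{R}$ be twice differentiable and strongly convex, let $f:\mathbb{R}^n\to\mathbb{R}$ be differentiable, convex and $\sigma$-uniformly convex with respect to $h$ for some $\sigma\ge0$, and let $x^*$ be a minimizer of $f$. Let $\alpha,\delta,\eta,\nu:[t_0,T]\to\mathbb{R}$ be differentiable functions such that for all $t\in[t_0,T]$ $$\begin{cases}\dot\nu(t)\le e^{\alpha(t)},\\ -[\dot\delta(t)+\dot\eta(t)-\dot\alpha(t)-e^{\alpha(t)}]+[\dot\nu(t)+\dot\eta(t)]\le0,\\ [\dot\delta(t)+\dot\eta(t)-\dot\alpha(t)-e^{\alpha(t)}]-\sigma e^{-\eta(t)+\alpha(t)}\le0,\\ -[\dot\delta(t)+\dot\eta(t)-\dot\alpha(t)-e^{\alpha(t)}]\le0.\end{cases}$$ Let $(x(t),z(t))$ be a solution on $[t_0,T]$ of the state equation $$\begin{cases}\dot x(t)=e^{\alpha(t)}(z(t)-x(t)),\\ \nabla^2h(z(t))\,\dot z(t)=-\bigl(\dot\delta(t)+\dot\eta(t)-\dot\alpha(t)-e^{\alpha(t)}\bigr)\bigl[\nabla h(z(t))-\nabla h(x(t))\bigr]-e^{-\eta(t)+\alpha(t)}\nabla f(x(t)).\end{cases}$$ Then the function $$V(t)=e^{\nu(t)}\bigl(e^{\eta(t)}\mathcal{D}_h(x^*,z(t))+[f(x(t))-f(x^* )]\bigr)$$ is nonincreasing on $[t_0,T]$; that is, $\dot V(t)\le0$ for all $t\in[t_0,T]$.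
   Context: The Bregman divergence of a differentiable convex function $h$ is $\mathcal{D}_h(y,x)=h(y)-h(x)-\nabla h(x)^\top(y-x)$. A differentiable $f$ is $\sigma$-uniformly convex with respect to $h$ ($\sigma\ge0$) if $\mathcal{D}_f(y,x)\ge\sigma\mathcal{D}_h(y,x)$ for all $x,y$. A dot denotes $d/dt$. Note that $z(t)=x(t)+e^{-\alpha(t)}\dot x(t)$ by the first state equation. *)

(* Defs.v *)
From HB Require Import structures.
From mathcomp Require Import all_boot all_order all_algebra.
From mathcomp Require Import all_classical all_reals all_analysis.

Set Implicit Arguments.
Unset Strict Implicit.
Unset Printing Implicit Defensive.

Import Order.TTheory GRing.Theory Num.Theory.
Import numFieldNormedType.Exports.

Local Open Scope classical_set_scope.
Local Open Scope ring_scope.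

(* Time derivative relative to a set A of times: on an interval `[t0, T]` it is
   the ordinary derivative at interior points and the one-sided derivative at
   the end points, and it only depends on the values of f on `[t0, T]`. *)
Section time_derivative.
Context {R : realType} {W : normedModType R}.
Implicit Types (A : set R) (f : R -> W) (t : R).

Definition derivable_within A f t : Prop :=
  cvg ((fun s => (s - t)^-1 *: (f s - f t)) @ within A t^').

(* Meaningful only under [derivable_within A f t], as usual with [lim]. *)
Definition dot A f t : W :=
  lim ((fun s => (s - t)^-1 *: (f s - f t)) @ within A t^').

End time_derivative.

Section calculus.
Context {R : realType} {n : nat}.
Implicit Types (h f : 'cV[R]_n -> R) (u v x y : 'cV[R]_n).

Definition inner u v : R := (u^T *m v) 0 0.

Definition grad h x : 'cV[R]_n := \col_i 'D_(delta_mx i 0) h x.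

Definition hess h x : 'M[R]_n :=
  \matrix_(i, j) 'D_(delta_mx j 0) (fun y => grad h y i 0) x.

Definition twice_differentiable h : Prop :=
  (forall x, differentiable h x) /\ (forall x, differentiable (grad h) x).

(* The norm is Euclidean: the library's norm on matrices is the sup norm. *)
Definition strongly_convex h : Prop :=
  exists2 mu : R, 0 < mu &
    forall (x y : 'cV[R]_n) (l : R), 0 <= l <= 1 ->
      h (l *: x + (1 - l) *: y) <=
        l * h x + (1 - l) * h y - mu / 2 * l * (1 - l) * inner (x - y) (x - y).

Definition bregman h y x : R := h y - h x - inner (grad h x) (y - x).

Definition uniformly_convex (sigma : R) h f : Prop :=
  forall x y, sigma * bregman h y x <= bregman f y x.

End calculus.

Section dynamics.
Context {R : realType}.
Implicit Types (A : set R) (alpha delta eta : R -> R).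

Definition damping A alpha delta eta (t : R) : R :=
  dot A delta t + dot A eta t - dot A alpha t - expR (alpha t).

Definition is_solution (n : nat) A (h f : 'cV[R]_n -> R) alpha delta eta
    (x z : R -> 'cV[R]_n) : Prop :=
  forall t, A t ->
    [/\ derivable_within A x t, derivable_within A z t,
        dot A x t = expR (alpha t) *: (z t - x t)
      & hess h (z t) *m dot A z t =
          - damping A alpha delta eta t *: (grad h (z t) - grad h (x t))
          - expR (- eta t + alpha t) *: grad f (x t)].

Definition lyapunov (n : nat) (h f : 'cV[R]_n -> R) (eta nu : R -> R)
    (xstar : 'cV[R]_n) (x z : R -> 'cV[R]_n) (t : R) : R :=
  expR (nu t) *
    (expR (eta t) * bregman h xstar (z t) + (f (x t) - f xstar)).

End dynamics.

(* Main.v *)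
(* Write y for the minimizer, rho for the damping and D for the Bregman
   divergence of h.  Then d/dt D(y, z) = - <hess h(z) dz, y - z>, which the state
   equation and the three-point identity turn into
     rho (D(y, x) - D(y, z) - D(z, x)) + e^(a - eta) <grad f(x), y - z>.
   Adding <grad f(x), dx> = e^a <grad f(x), z - x> to e^eta times this leaves
   e^a <grad f(x), y - x>, which uniform convexity bounds by
   e^a (f(y) - f(x) - sigma D(y, x)).  Hence e^(- nu) dV/dt is at most
     (dnu + deta - rho) e^eta D(y, z) + (dnu - e^a) (f(x) - f(y))
       + (rho e^eta - sigma e^a) D(y, x) - rho e^eta D(z, x),
   and the assumed inequalities make each of the four terms nonpositive. *)
Require Import Defs.
From mathcomp Require Import all_boot all_order all_algebra.
From mathcomp Require Import all_classical all_reals all_analysis.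
From mathcomp Require Import ring lra.

Set Implicit Arguments.
Unset Strict Implicit.
Unset Printing Implicit Defensive.

Import Order.TTheory GRing.Theory Num.Theory.
Import numFieldNormedType.Exports.

Local Open Scope classical_set_scope.
Local Open Scope ring_scope.

(** * Derivatives relative to a set of times *)

Section within_derivative.
Context {R : realType} {W : normedModType R}.
Implicit Types (A : set R) (u g : R -> W) (t : R).

(* Extending u affinely outside A reduces derivatives relative to A, one-sided
   ones included, to the ordinary differential calculus. *)
Lemma derivable_within_extension A u t : A t -> derivable_within A u t ->
  exists2 g, (forall s, A s -> u s = g s) & is_derive t 1 g (dot A u t).
Proof.
move=> At cu; set l := dot A u t.
have {}cu : (fun s => (s - t)^-1 *: (u s - u t)) @ within A t^' --> l by [].
exists (fun s => if s \in A then u s else u t + (s - t) *: l).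
  by move=> s As; rewrite mem_set.
suff dg : (fun k : R => k^-1 *: ((if k *: (1 : R) + t \in A then
      u (k *: (1 : R) + t) else u t + (k *: (1 : R) + t - t) *: l) -
      (if t \in A then u t else u t + (t - t) *: l))) @ 0^' --> l.
  by apply: DeriveDef; [apply/cvg_ex; exists l|exact: cvg_lim].
apply/cvgrPdist_le => e e0; rewrite mem_set//.
have /cvgrPdist_le /(_ e e0) := cu.
rewrite /within/= /dnbhs /within/= => /nbhs_ballP [r /= r0 H].
apply/nbhs_ballP; exists r => //= k; rewrite -ball_normE /ball/= sub0r normrN => kr k0.
have -> : k *: (1 : R) = k by rewrite /GRing.scale/= mulr1.
case: ifPn => [/set_mem Ak|_].
  have := H (k + t); rewrite addrK; apply => //.
    by rewrite -ball_normE/= opprD addrCA subrr addr0 normrN.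
  by rewrite -subr_eq0 addrK.
by rewrite addrAC subrr add0r addrK scalerA mulVf// scale1r subrr normr0 ltW.
Qed.

(** Converse transfer, from an ordinary derivative back to [A]: the quotients of [u] and [g] agree
    at points of [A]. Properness of the filter makes the limit unique, so that [dot] really returns
    [l]. *)
Lemma is_derive_within A u g t l : ProperFilter (within A t^') -> A t ->
  (forall s, A s -> u s = g s) -> is_derive t 1 g l ->
  derivable_within A u t /\ dot A u t = l.
Proof.
move=> PF At ug [dg gl].
suff cu : (fun s => (s - t)^-1 *: (u s - u t)) @ within A t^' --> l.
  by split; [apply/cvg_ex; exists l|exact: cvg_lim].
have {dg gl} : (fun k : R => k^-1 *: (g (k *: (1 : R) + t) - g t)) @ 0^' --> l.
  by rewrite -gl.
move=> /cvgrPdist_le dg; apply/cvgrPdist_le => e /dg.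
rewrite /within/= /dnbhs /within/= => /nbhs_ballP [r /= r0 H].
apply/nbhs_ballP; exists r => //= s; rewrite -ball_normE/= => str st As.
have := H (s - t); rewrite -ball_normE/= sub0r opprB => /(_ str).
rewrite subr_eq0 => /(_ st).
have -> : (s - t) *: (1 : R) = s - t by rewrite /GRing.scale/= mulr1.
by rewrite subrK !ug.
Qed.

End within_derivative.

Lemma within_dnbhs_itv_proper (R : realType) (a b t : R) :
  a < b -> t \in `[a, b] -> ProperFilter (within `[a, b] t^').
Proof.
move=> ab; rewrite in_itv/= => /andP[at_ tb].
apply: Build_ProperFilter => /=.
rewrite /within/= /dnbhs /within/= => /nbhs_ballP [r /= r0 H].
(* The bound [r / 2] keeps the new point in the ball; the bound by half the length keeps it in the
   interval when moving from [t] towards the farther end. *)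
pose d := Num.min (r / 2) ((b - a) / 2).
have d0 : 0 < d by rewrite lt_min !divr_gt0// subr_gt0.
have dr : d < r by rewrite gt_min; apply/orP; left; lra.
have dab : d <= (b - a) / 2 by rewrite ge_min lexx orbT.
have [tm|tm] := leP t ((a + b) / 2).
- apply: (H (t + d)).
  + by rewrite -ball_normE/= opprD addNKr normrN gtr0_norm.
  + by rewrite -subr_eq0 addrAC subrr add0r gt_eqF.
  + by rewrite /= in_itv/=; apply/andP; split; lra.
- apply: (H (t - d)).
  + by rewrite -ball_normE/= opprB addrCA subrr addr0 gtr0_norm.
  + by rewrite -subr_eq0 addrAC subrr add0r oppr_eq0 gt_eqF.
  + by rewrite /= in_itv/=; apply/andP; split; lra.
Qed.

Lemma dot_le0_nincr (R : realType) (a b : R) (v : R -> R) : a < b ->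
  (forall t, t \in `[a, b] ->
    derivable_within `[a, b] v t /\ dot `[a, b] v t <= 0) ->
  forall s t, s \in `[a, b] -> t \in `[a, b] -> s <= t -> v t <= v s.
Proof.
move=> ab dv s t sab tab st.
have inner_derive c : c \in `]a, b[ -> is_derive c 1 v (dot `[a, b] v c).
  move=> cab; have cab' : c \in `[a, b] by exact: subset_itv_oo_cc.
  have [g vg dg] := derivable_within_extension cab' (dv c cab').1.
  apply: near_eq_is_derive dg.
  near=> y; apply/esym/vg => /=; apply: subset_itv_oo_cc.
  by near: y; exact: near_in_itvoo.
apply: (@ler0_derive1_le_cc _ v a b) => //.
- by move=> c /inner_derive.
- move=> c cab; rewrite derive1E; have [_ ->] := inner_derive c cab.
  by apply: (dv c _).2; exact: subset_itv_oo_cc.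
(* Continuity up to the end points: the extension is differentiable, hence continuous, at [c], and
   agrees with [v] on the interval. *)
- apply/subspace_continuousP => c cab.
  have [g vg [dg _]] := derivable_within_extension cab (dv c cab).1.
  have cg : {for c, continuous g}.
    by apply: differentiable_continuous; exact/derivable1_diffP.
  rewrite /from_subspace (vg c cab).
  have cgw : g @ within `[a, b] (nbhs c) --> g c by exact: cvg_within_filter.
  apply: cvg_trans cgw.
  by apply: fmap_within_eq => y /set_mem/vg.
Unshelve. all: by end_near. Qed.

Lemma is_derive_diff_comp (R : realFieldType) (V W : normedModType R)
    (g : V -> W) (u : R -> V) (t : R) (l : V) :
  differentiable g (u t) -> is_derive t 1 u l ->
  is_derive t 1 (g \o u) ('d g (u t) l).
Proof.
move=> dg [/derivable1_diffP du <-].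
have dgu : differentiable (g \o u) t by exact: differentiable_comp.
apply: DeriveDef; first exact: diff_derivable.
by rewrite !deriveE// diff_comp.
Qed.

(** * Euclidean inner product *)

Section inner_product.
Context {R : realType} {n : nat}.
Implicit Types (u v w : 'cV[R]_n).

Lemma innerE u v : inner u v = \sum_i u i 0 * v i 0.
Proof. by rewrite /inner mxE; apply: eq_bigr => i _; rewrite mxE. Qed.

Lemma innerDl u v w : inner (u + v) w = inner u w + inner v w.
Proof. by rewrite /inner linearD mulmxDl mxE. Qed.

Lemma innerDr u v w : inner u (v + w) = inner u v + inner u w.
Proof. by rewrite /inner mulmxDr mxE. Qed.

Lemma innerZl (a : R) u v : inner (a *: u) v = a * inner u v.
Proof. by rewrite /inner linearZ -scalemxAl mxE. Qed.

Lemma innerZr (a : R) u v : inner u (a *: v) = a * inner u v.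
Proof. by rewrite /inner -scalemxAr mxE. Qed.

Lemma innerNl u v : inner (- u) v = - inner u v.
Proof. by rewrite -scaleN1r innerZl mulN1r. Qed.

Lemma innerNr u v : inner u (- v) = - inner u v.
Proof. by rewrite -scaleN1r innerZr mulN1r. Qed.

Lemma inner_ge0 u : 0 <= inner u u.
Proof. by rewrite innerE sumr_ge0// => i _; rewrite -expr2 sqr_ge0. Qed.

Lemma is_derive_inner (p q : R -> 'cV[R]_n) (t : R) dp dq :
  is_derive t 1 p dp -> is_derive t 1 q dq ->
  is_derive t 1 (fun s => inner (p s) (q s)) (inner dp (q t) + inner (p t) dq).
Proof.
have coord (r : R -> 'cV[R]_n) dr i : is_derive t 1 r dr ->
    is_derive t 1 (fun s => r s i 0) (dr i 0).
  move=> [er <-]; apply: DeriveDef; first by move/derivable_mxP: er.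
  by rewrite derive_mx// mxE.
move=> pdp qdq.
(* As a finite sum of products of scalar coordinates, the pairing falls under the scalar Leibniz
   rule. *)
have -> : (fun s => inner (p s) (q s)) =
    \sum_(i < n) ((fun s => p s i 0) * (fun s => q s i 0) : R -> R).
  by apply/funext => s; rewrite innerE fct_sumE.
have H (i : 'I_n) : is_derive t 1 ((fun s => p s i 0) * (fun s => q s i 0) : R -> R)
    (p t i 0 *: dq i 0 + q t i 0 *: dp i 0).
  by apply: is_deriveM; exact: coord.
apply: is_derive_eq (is_derive_sum H) _.
rewrite !innerE -big_split/=; apply: eq_bigr => i _.
by rewrite addrC /GRing.scale/= [_ * dp i 0]mulrC.
Qed.

End inner_product.

(** * Gradient, Hessian and Bregman divergence *)

Section gradient.
Context {R : realType} {n : nat}.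
Implicit Types (h f : 'cV[R]_n -> R) (x y v : 'cV[R]_n).

Lemma cV_sum_delta v : v = \sum_i v i 0 *: delta_mx i 0.
Proof.
by rewrite [LHS]matrix_sum_delta; apply: eq_bigr => i _; rewrite big_ord1.
Qed.

Lemma inner_grad h x v : differentiable h x -> inner (grad h x) v = 'd h x v.
Proof.
move=> dh; rewrite innerE [in RHS](cV_sum_delta v) linear_sum.
by apply: eq_bigr => i _; rewrite linearZ mxE deriveE// mulrC.
Qed.

Lemma hess_mulmx h x v : differentiable (grad h) x ->
  hess h x *m v = 'd (grad h) x v.
Proof.
move=> dh; rewrite [in RHS](cV_sum_delta v) linear_sum.
apply/matrixP => i j; rewrite !mxE summxE ord1; apply: eq_bigr => k _.
rewrite linearZ !mxE -deriveE// derive_mx; last exact: diff_derivable.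
by rewrite !mxE mulrC.
Qed.

(** All values of [h] cancel on the right, and so do the base points of the linear terms. *)
Lemma three_point h x y z :
  inner (grad h z - grad h x) (y - z) =
  bregman h y x - bregman h y z - bregman h z x.
Proof. by rewrite /bregman !(innerDl, innerDr, innerNl, innerNr); ring. Qed.

(** First-order form of convexity: for [0 < k < 1] the difference quotient of [h] at [x] towards [y]
    is at most [h y - h x], and letting [k] tend to 0 from the right gives the bound for the
    derivative. *)
Lemma bregman_ge0 h : (forall x, differentiable h x) -> strongly_convex h ->
  forall x y, 0 <= bregman h y x.
Proof.
move=> dh [mu mu0 hsc] x y.
rewrite /bregman inner_grad// -deriveE// subr_ge0.
have dhx : k^-1 *: ((h \o shift x) (k *: (y - x)) - h x) @[k --> 0^'] -->
    'D_(y - x) h x by exact: diff_derivable.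
apply: (cvgr_to_le (cvg_dnbhs_at_right dhx)); near=> k.
have k0 : 0 < k by near: k; exact: nbhs_right_gt.
have k1 : k < 1 by near: k; exact: nbhs_right_lt.
rewrite /= /shift/= -[k^-1 *: _]/(k^-1 * _) mulrC ler_pdivrMr//.
have -> : k *: (y - x) + x = k *: y + (1 - k) *: x.
  by rewrite scalerBr scalerBl scale1r addrAC addrA.
have := hsc y x k; rewrite (ltW k0) (ltW k1) => /(_ isT) hk.
have : 0 <= mu / 2 * k * (1 - k) * inner (y - x) (y - x).
  by rewrite mulr_ge0 ?inner_ge0// !mulr_ge0 ?subr_ge0// ltW.
move: hk; set w := mu / 2 * _ * _ * _; lra.
Unshelve. all: by end_near. Qed.

(** Differentiating [- h (z s)] gives [- inner (grad h (z t)) dz], which cancels against the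
    derivative of [y - z s] in the linear term; only the variation of the gradient survives. *)
Lemma is_derive_bregman h (z : R -> 'cV[R]_n) y (t : R) dz :
  twice_differentiable h -> is_derive t 1 z dz ->
  is_derive t 1 (fun s => bregman h y (z s))
    (- inner (hess h (z t) *m dz) (y - z t)).
Proof.
move=> [dh dgh] zdz.
have hz := is_derive_diff_comp (dh (z t)) zdz.
have ghz := is_derive_diff_comp (dgh (z t)) zdz.
have yz : is_derive t 1 (fun s => y - z s) (0 - dz) by exact: is_deriveB.
have hyz := is_deriveB (is_derive_cst (h y) t 1) hz.
apply: is_derive_eq (is_deriveB hyz (is_derive_inner ghz yz)) _.
rewrite hess_mulmx// -inner_grad// !sub0r innerNr /=; ring.
Qed.

End gradient.

(** * The Lyapunov function and the sign of its rate *)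

Lemma is_derive_lyapunov (R : realType) (n : nat) (h f : 'cV[R]_n -> R)
    (eta nu : R -> R) (y : 'cV[R]_n) (x z : R -> 'cV[R]_n) (t : R)
    (deta dnu : R) (dx dz : 'cV[R]_n) :
  twice_differentiable h -> differentiable f (x t) ->
  is_derive t 1 eta deta -> is_derive t 1 nu dnu ->
  is_derive t 1 x dx -> is_derive t 1 z dz ->
  is_derive t 1 (lyapunov h f eta nu y x z)
    (expR (nu t) *
      (dnu * (expR (eta t) * bregman h y (z t) + (f (x t) - f y)) +
       expR (eta t) * (deta * bregman h y (z t) -
                       inner (hess h (z t) *m dz) (y - z t)) +
       inner (grad f (x t)) dx)).
Proof.
move=> dh df deta' dnu' dx' dz'.
have eeta := is_derive1_comp (is_derive_expR (eta t)) deta'.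
have enu := is_derive1_comp (is_derive_expR (nu t)) dnu'.
have dfx := is_derive_diff_comp df dx'.
have dD := is_derive_bregman y dh dz'.
have dgap := is_deriveB dfx (is_derive_cst (f y) t 1).
have dsum : is_derive t 1
    (fun s => expR (eta s) * bregman h y (z s) + (f (x s) - f y)) _ :=
  is_deriveD (is_deriveM eeta dD) dgap.
apply: is_derive_eq (is_deriveM enu dsum) _.
rewrite inner_grad// -![_ *: _]/(_ * _) /=.
by ring.
Qed.

(** The estimate at one frozen time: derivatives enter as plain numbers and vectors tied by the
    state equation, so only algebra and convexity remain. *)
Lemma lyapunov_rate_le0 (R : realType) (n : nat) (h f : 'cV[R]_n -> R)
    (sigma rho a eta deta dnu : R) (y x z dx dz : 'cV[R]_n) :
  (forall u, differentiable h u) -> strongly_convex h ->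
  uniformly_convex sigma h f -> f y <= f x ->
  dnu <= expR a -> dnu + deta <= rho -> rho <= sigma * expR (- eta + a) ->
  0 <= rho ->
  dx = expR a *: (z - x) ->
  hess h z *m dz =
    - rho *: (grad h z - grad h x) - expR (- eta + a) *: grad f x ->
  dnu * (expR eta * bregman h y z + (f x - f y)) +
  expR eta * (deta * bregman h y z - inner (hess h z *m dz) (y - z)) +
  inner (grad f x) dx <= 0.
Proof.
move=> dh hsc fuc fyx nua nueta rhos rho0 -> ->.
have Dyz := bregman_ge0 dh hsc z y; have Dzx := bregman_ge0 dh hsc x z.
have Dyx := bregman_ge0 dh hsc x y; have := fuc x y.
rewrite [bregman f _ _]/bregman.
(* Splitting at [z] matches the two gradient terms present: [y - z] from the Bregman part and
   [z - x] from the velocity [dx]. *)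
have -> : y - x = (y - z) + (z - x) by rewrite addrA subrK.
rewrite innerDr innerDl !innerNl !innerZl three_point innerZr.
have E : expR eta * expR (- eta + a) = expR a by rewrite -expRD addrA subrr add0r.
have e0 := expR_gt0 eta; have a0 := expR_gt0 a.
move: Dyz Dzx Dyx E rhos.
set A := bregman h y z; set B := bregman h z x; set C := bregman h y x.
set g1 := inner _ (y - z); set g2 := inner _ (z - x).
move=> A0 B0 C0 E rhos fsc.
have h1 : (dnu + deta - rho) * (expR eta * A) <= 0.
  by rewrite mulr_le0_ge0 ?mulr_ge0 ?(ltW e0)// subr_le0.
have h2 : (dnu - expR a) * (f x - f y) <= 0.
  by rewrite mulr_le0_ge0 ?subr_ge0// subr_le0.
have h3 : (expR eta * rho - sigma * expR a) * C <= 0.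
  rewrite mulr_le0_ge0// subr_le0 -E mulrCA.
  by rewrite ler_pM2l.
have h4 : 0 <= expR eta * rho * B by rewrite !mulr_ge0// ltW.
have h5 : expR a * (sigma * C) <= expR a * (f y - f x - (g1 + g2)).
  by rewrite ler_pM2l.
(* Exact regrouping into the four signed terms, the slack [h5] of uniform convexity, and a multiple
   of [g1] that vanishes by [E]; the last is kept apart because [ring] treats exponentials as
   atoms. *)
rewrite [X in X <= 0](_ : _ =
  (dnu + deta - rho) * (expR eta * A) + (dnu - expR a) * (f x - f y) +
  (expR eta * rho - sigma * expR a) * C - expR eta * rho * B +
  (expR a * (sigma * C) - expR a * (f y - f x - (g1 + g2))) +
  (expR eta * expR (- eta + a) - expR a) * g1); last by ring.
by rewrite E; lra.
Qed.

Theorem theorem2 (R : realType) (n : nat) (h f : 'cV[R]_n -> R)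
  (sigma : R) (xstar : 'cV[R]_n) (t0 T : R)
  (alpha delta eta nu : R -> R) (x z : R -> 'cV[R]_n)
  (h_diff : twice_differentiable h) (h_sc : strongly_convex h)
  (f_diff : forall u, differentiable f u)
  (f_convex : convex_function [set: 'cV[R]_n] f)
  (sigma_ge0 : 0 <= sigma)
  (f_uc : uniformly_convex sigma h f)
  (xstar_min : forall u, f xstar <= f u)
  (t0T : t0 < T)
  (param_diff : forall t, t \in `[t0, T] ->
     [/\ derivable_within `[t0, T] alpha t, derivable_within `[t0, T] delta t,
         derivable_within `[t0, T] eta t & derivable_within `[t0, T] nu t])
  (param_ineq : forall t, t \in `[t0, T] ->
     [/\ dot `[t0, T] nu t <= expR (alpha t),
         - damping `[t0, T] alpha delta eta t
           + (dot `[t0, T] nu t + dot `[t0, T] eta t) <= 0,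
         damping `[t0, T] alpha delta eta t
           - sigma * expR (- eta t + alpha t) <= 0
       & - damping `[t0, T] alpha delta eta t <= 0])
  (xz_sol : is_solution `[t0, T] h f alpha delta eta x z) :
  (forall s t, s \in `[t0, T] -> t \in `[t0, T] -> s <= t ->
     lyapunov h f eta nu xstar x z t <= lyapunov h f eta nu xstar x z s) /\
  (forall t, t \in `[t0, T] ->
     derivable_within `[t0, T] (lyapunov h f eta nu xstar x z) t /\
     dot `[t0, T] (lyapunov h f eta nu xstar x z) t <= 0).
Proof.
suff rate t : t \in `[t0, T] ->
    derivable_within `[t0, T] (lyapunov h f eta nu xstar x z) t /\
    dot `[t0, T] (lyapunov h f eta nu xstar x z) t <= 0.
  by split=> //; exact: dot_le0_nincr.
move=> tT; have [_ _ deta dnu] := param_diff _ tT.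
have [nua nueta rhos rho0] := param_ineq _ tT.
have [dx dz xE zE] := xz_sol _ tT.
(* With [t] fixed, each curve is replaced by an extension differentiable at [t] in the ordinary
   sense; agreement on the interval carries the computed rate back to the original data. *)
have [eta' etaE deta'] := derivable_within_extension tT deta.
have [nu' nuE dnu'] := derivable_within_extension tT dnu.
have [x' xE' dx'] := derivable_within_extension tT dx.
have [z' zE' dz'] := derivable_within_extension tT dz.
have VE s : `[t0, T]%classic s ->
    lyapunov h f eta nu xstar x z s = lyapunov h f eta' nu' xstar x' z' s.
  by move=> sT; rewrite /lyapunov etaE// nuE// xE'// zE'.
have dV := is_derive_lyapunov xstar h_diff (f_diff _) deta' dnu' dx' dz'.
have [dVw ->] := is_derive_within (within_dnbhs_itv_proper t0T tT) tT VE dV.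
split=> //; rewrite -etaE// -nuE// -xE'// -zE'//.
rewrite pmulr_rle0 ?expR_gt0//.
apply: (lyapunov_rate_le0 h_diff.1 h_sc f_uc (xstar_min _) nua _ _ _ xE zE).
- by lra.
- by lra.
- by lra.
Qed.
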